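(* Let $\lambda\in(0,\infty)$ and $\boldsymbol r=(r_1,r_2,\ldots)\in\ell_1^{\downarrow}$. Then there is a unique pair $(\boldsymbol g,\boldsymbol v)\in C([0,\infty):\ell_1^{\downarrow}\times\ell_\infty)$, $\boldsymbol g=(g_i)_{i\ge1}$, $\boldsymbol v=(v_i)_{i\ge1}$, that solves the system of equations $$g_i(t)=\Gamma_1\Big(r_i-\int_0^{\cdot}(g_i(s)-g_{i+1}(s))\,ds+v_{i-1}(\cdot)\Big)(t),\qquad i\ge1,\ t\ge0,$$ $$v_i(t)=\hat\Gamma_1\Big(r_i-\int_0^{\cdot}(g_i(s)-g_{i+1}(s))\,ds+v_{i-1}(\cdot)\Big)(t),\qquad i\ge1,\ t\ge0,$$ where $v_0(t)=\lambda t$ for $t\ge0$.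
   Context: $\ell_p$ is the space of real sequences $\boldsymbol x=(x_1,x_2,\ldots)$ with finite usual norm $\|\boldsymbol x\|_p$. $\ell_1^{\downarrow}=\{\boldsymbol x\in\ell_1: x_i\ge x_{i+1},\ x_i\in[0,1]\ \forall i\in\mathbb N\}$, with the topology generated by $\|\cdot\|_1$. $C([0,\infty):S)$ denotes continuous functions from $[0,\infty)$ to $S$. One-dimensional Skorohod map with reflection at $\alpha\in\mathbb R$: for a right-continuous function with left limits $f:[0,\infty)\to\mathbb R$ with $f(0)\le\alpha$, $$\hat\Gamma_\alpha(f)(t)=\sup_{s\in[0,t]}(f(s)-\alpha)^+,\qquad \Gamma_\alpha(f)(t)=f(t)-\hat\Gamma_\alpha(f)(t).$$ *)

(* Defs.v *)
From HB Require Import structures.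
From mathcomp Require Import all_boot all_order all_algebra.
From mathcomp Require Import all_classical all_reals all_analysis.

Set Implicit Arguments.
Unset Strict Implicit.
Unset Printing Implicit Defensive.

Import Order.TTheory GRing.Theory Num.Theory.
Import numFieldTopology.Exports numFieldNormedType.Exports.

Local Open Scope classical_set_scope.
Local Open Scope ring_scope.

(* A real sequence (x_1, x_2, ...) is a function x : nat -> R with x n = x_{n+1}.
   l_p is the library's L^p for the counting measure on nat. *)
Definition ell (R : realType) (p : \bar R) : set (nat -> R) :=
  [set x | x \in Lfun (@counting nat R) p].

Definition ell_norm (R : realType) (p : \bar R) (x : nat -> R) : \bar R :=
  ('N[@counting nat R]_p[EFin \o x])%E.

Definition ell1_down (R : realType) : set (nat -> R) :=
  [set x | [/\ ell 1%E x,
               forall i, x i.+1 <= x i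
             & forall i, 0 <= x i <= 1]].

(* C([0, oo) : S) for S a subset of l_p with the norm topology. Paths are
   functions on R of which only the values at t >= 0 matter. *)
Definition ell_paths (R : realType) (p : \bar R) (S : set (nat -> R)) :
    set (R -> nat -> R) :=
  [set x | (forall t : R, 0 <= t -> S (x t)) /\
           (forall t : R, 0 <= t ->
              ell_norm p (fun i => x s i - x t i)
                @[s --> within `[0, +oo[ (nbhs t)] --> 0%E)].

Definition rcll (R : realType) (f : R -> R) : Prop :=
  (forall t : R, 0 <= t -> f s @[s --> t^'+] --> f t) /\
  (forall t : R, 0 < t -> cvg (f s @[s --> t^'-])).

Definition skorohod_dom (R : realType) (alpha : R) : set (R -> R) :=
  [set f | rcll f /\ f 0 <= alpha].

Definition skorohod_hat (R : realType) (alpha : R) (f : R -> R) (t : R) : R :=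
  sup [set Num.max (f s - alpha) 0 | s in `[0, t]].

Definition skorohod (R : realType) (alpha : R) (f : R -> R) (t : R) : R :=
  f t - skorohod_hat alpha f t.

(* v_prev lambda v n is v_{i-1} for i = n + 1, with v_0(t) = lambda t. *)
Definition v_prev (R : realType) (lambda : R) (v : R -> nat -> R)
    (n : nat) (t : R) : R :=
  if n is m.+1 then v t m else lambda * t.

Definition sys_input (R : realType) (lambda : R) (r : nat -> R)
    (g v : R -> nat -> R) (n : nat) (t : R) : R :=
  r n - \int[lebesgue_measure]_(s in `[0, t]) (g s n - g s n.+1)
  + v_prev lambda v n t.

(* The first clause makes the applications of the Skorohod map in the other
   two meaningful. *)
Definition solves_system (R : realType) (lambda : R) (r : nat -> R)
    (g v : R -> nat -> R) : Prop :=
  forall n : nat,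
    [/\ skorohod_dom 1 (sys_input lambda r g v n),
        forall t : R, 0 <= t -> g t n = skorohod 1 (sys_input lambda r g v n) t
      & forall t : R, 0 <= t -> v t n = skorohod_hat 1 (sys_input lambda r g v n) t].

(* By the universal property of the product topology, a path in
   C([0, oo) : l_1-down x l_oo) is a pair of continuous paths. *)
Definition is_solution (R : realType) (lambda : R) (r : nat -> R)
    (g v : R -> nat -> R) : Prop :=
  [/\ ell_paths 1%E (@ell1_down R) g,
      ell_paths +oo%E (ell +oo%E) v
    & solves_system lambda r g v].

(* Main.v *)
(** Eliminating v along i = 1, 2, ... turns the system into a fixed point
    equation g = Phi(g).  Its n-th coordinate involves only g_1, ..., g_(n+1),
    and the Skorohod maps are Lipschitz for the sup norm, so in the weighted
    distance sup_n 2^-n |g_n - h_n| the map Phi satisfies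
    d(Phi g, Phi h)(t) <= 12 int_0^t d(g, h).  Picard iteration therefore
    converges locally uniformly in each coordinate, and fixed points that are
    locally bounded in the weighted norm are unique.

    The limit takes values in l_1-down: g_n and g_n - g_(n+1) cannot become
    negative, because v_n is constant while g_n < 1, so on an excursion below 0
    they satisfy x_n' >= - x_n + x_(n+1).  Summing the equations gives
    sum_(n < M) g_n(t) <= |r|_1 + lambda t; as g_n is decreasing in n, it is
    below 1 on [0, T] for all large n, where v_n then vanishes.  Hence the tails
    of g are dominated by those of r, which yields the norm continuity. *)
Require Import Defs.
From mathcomp Require Import all_boot all_order all_algebra.
From mathcomp Require Import all_classical all_reals all_analysis.
From mathcomp Require Import ring lra.

Set Implicit Arguments.
Unset Strict Implicit.
Unset Printing Implicit Defensive.

Import Order.TTheory GRing.Theory Num.Theory.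
Import numFieldTopology.Exports numFieldNormedType.Exports.

Local Open Scope classical_set_scope.
Local Open Scope ring_scope.

(** * Integrals of continuous functions from 0 to t *)

Section Primitive.
Variable R : realType.
Implicit Types (f g : R -> R) (s t : R).

Definition prim f t : R := \int[lebesgue_measure]_(s in `[0, t]) f s.

Lemma continuous_integrable_itvcc f s t : continuous f ->
  (@lebesgue_measure R).-integrable `[s, t] (EFin \o f).
Proof.
move=> cf; apply: continuous_compact_integrable; first exact: segment_compact.
exact: continuous_subspaceT.
Qed.

Lemma continuous_integrable_itvoc f s t : continuous f ->
  (@lebesgue_measure R).-integrable `]s, t] (EFin \o f).
Proof.
move=> cf; apply: (integrableS _ _ _ (continuous_integrable_itvcc s t cf)) => //.
by move=> u /=; rewrite !in_itv/= => /andP[/ltW->->].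
Qed.

Lemma prim_npos f t : t <= 0 -> prim f t = 0.
Proof.
rewrite le_eqVlt => /predU1P[->|t0]; first by rewrite /prim set_itv1 Rintegral_set1.
by rewrite /prim set_itv_ge ?Rintegral_set0// bnd_simp -ltNge.
Qed.

Lemma prim_increment f s t : continuous f -> 0 <= s -> s <= t ->
  prim f t - prim f s = \int[lebesgue_measure]_(u in `]s, t]) f u.
Proof.
move=> cf s0 st; apply: Rintegral_itvB; rewrite ?bnd_simp//.
exact: continuous_integrable_itvcc.
Qed.

(** The increment is an integral over []s, t]], so nothing is asked at s itself. This suits
    excursions that begin just after a last nonnegative time. *)
Lemma prim_increment_le f g s t : continuous f -> continuous g ->
  0 <= s -> s <= t -> (forall u, s < u <= t -> f u <= g u) ->
  prim f t - prim f s <= prim g t - prim g s.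
Proof.
move=> cf cg s0 st fg; rewrite !prim_increment//.
by apply: le_Rintegral => //; exact: continuous_integrable_itvoc.
Qed.

Lemma prim_le f g t : continuous f -> continuous g -> 0 <= t ->
  (forall u, 0 <= u <= t -> f u <= g u) -> prim f t <= prim g t.
Proof.
move=> cf cg t0 fg.
have := @prim_increment_le f g 0 t cf cg (lexx _) t0.
rewrite !(prim_npos _ (lexx 0)) !subr0; apply => u /andP[u0 ut].
by apply: fg; rewrite (ltW u0).
Qed.

Lemma prim_cst c t : 0 <= t -> prim (fun=> c) t = c * t.
Proof.
move=> t0; rewrite /prim Rintegral_cst//= lebesgue_measure_itv/= lte_fin.
case: ltP => [_|t0']; first by rewrite -EFinD subr0.
by rewrite (@le_anti _ _ t 0) ?t0'// mulr0.
Qed.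

Lemma primB f g t : continuous f -> continuous g ->
  prim (fun s => f s - g s) t = prim f t - prim g t.
Proof. by move=> cf cg; rewrite /prim RintegralB//; exact: continuous_integrable_itvcc. Qed.

Lemma primZ c f t : continuous f -> prim (fun s => c * f s) t = c * prim f t.
Proof. by move=> cf; rewrite /prim RintegralZl//; exact: continuous_integrable_itvcc. Qed.

(** Monomials are the error majorants of the Picard iteration; the divisions by k + 1 build up the
    factorial of the exponential series. *)
Lemma prim_exprn k t : 0 <= t -> prim (fun s => s ^+ k) t = t ^+ k.+1 / k.+1%:R.
Proof.
rewrite le_eqVlt => /predU1P[<-|t0]; first by rewrite prim_npos// expr0n mul0r.
have ck : continuous (fun s : R => s ^+ k) by exact: exprn_continuous.
have cF : continuous (fun s : R => k.+1%:R^-1 * s ^+ k.+1).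
  by move=> x; apply: cvgM; [exact: cvg_cst|exact: exprn_continuous].
rewrite /prim /Rintegral.
rewrite (@continuous_FTC2 _ (fun s => s ^+ k) (fun s => k.+1%:R^-1 * s ^+ k.+1) 0 t t0).
- by rewrite -EFinD/= expr0n mulr0 subr0 mulrC.
- exact: continuous_subspaceT.
- split.
  + by move=> x _; apply: derivableM; [exact: derivable_cst|exact: exprn_derivable].
  + by apply: cvg_at_right_filter; exact: cF.
  + by apply: cvg_at_left_filter; exact: cF.
- move=> x _; rewrite derive1E deriveM//; last exact: exprn_derivable.
  rewrite derive_cst scaler0 addr0 exp_derive /GRing.scale /= mulr1.
  by rewrite -mulr_natl mulrA mulVf ?mul1r.
Qed.

Lemma prim_norm_le f g t : continuous f -> continuous g -> 0 <= t ->
  (forall u, 0 <= u <= t -> `|f u| <= g u) -> `|prim f t| <= prim g t.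
Proof.
move=> cf cg t0 fg.
have cN : continuous (fun u => - 1 * g u).
  by move=> x; apply: cvgM; [exact: cvg_cst|exact: cg].
rewrite ler_norml -mulN1r -primZ//.
apply/andP; split; apply: prim_le => // u /fg; rewrite ?mulN1r ler_norml => /andP[]//.
Qed.

(** If |f| <= M on [0, |x| + 1], the primitive is M-Lipschitz up to time |x| + 1. Negative times are
    covered because the primitive vanishes there. *)
Lemma prim_continuous f : continuous f -> continuous (prim f).
Proof.
move=> cf x.
have [M M0 fM] : exists2 M, 0 < M & forall u, 0 <= u <= `|x| + 1 -> `|f u| <= M.
  have := continuous_compact (continuous_subspaceT cf) (@segment_compact _ 0 (`|x| + 1)).
  move=> /compact_bounded[M [_ bM]].
  exists (`|M| + 1); first by rewrite ltr_wpDl.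
  move=> u ux; apply: (bM (`|M| + 1)); last by exists u.
  by rewrite (le_lt_trans (ler_norm M))// ltrDl.
have lip s t : s <= t -> t <= `|x| + 1 -> `|prim f t - prim f s| <= M * (t - s).
  move=> st tx.
  have cM c : continuous (fun _ : R => c : R) by move=> ?; exact: cvg_cst.
  have H s' : 0 <= s' -> s' <= t -> `|prim f t - prim f s'| <= M * (t - s').
    move=> s0 st'; rewrite ler_norml mulrBr -!prim_cst ?(le_trans s0)//.
    have : prim (fun _ => - M) t - prim (fun _ => - M) s' <= prim f t - prim f s'.
      apply: prim_increment_le => // u /andP[su ut].
      have := fM u; rewrite ler_norml (le_trans s0 (ltW su)) (le_trans ut tx).
      by move=> /(_ isT)/andP[].
    have : prim f t - prim f s' <= prim (fun _ => M) t - prim (fun _ => M) s'.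
      apply: prim_increment_le => // u /andP[su ut].
      have := fM u; rewrite ler_norml (le_trans s0 (ltW su)) (le_trans ut tx).
      by move=> /(_ isT)/andP[].
    rewrite !prim_cst ?(le_trans s0)// => -> ; rewrite andbT.
    by rewrite !mulNr opprB; apply: le_trans; rewrite opprK addrC.
  have [s0|s0] := leP 0 s; first exact: H.
  rewrite (prim_npos _ (ltW s0)) subr0.
  have [t0|t0] := leP 0 t; last first.
    by rewrite (prim_npos _ (ltW t0)) normr0 mulr_ge0 ?subr_ge0// ltW.
  have := H 0 (lexx _) t0; rewrite (prim_npos _ (lexx 0)) !subr0 => /le_trans; apply.
  by rewrite ler_pM2l// lerDl oppr_ge0 ltW.
apply/cvgrPdist_le => e e0; near=> y.
have xy : `|x - y| <= e / M by near: y; apply: cvgr_dist_le; rewrite ?divr_gt0.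
have yx : y <= `|x| + 1.
  have : `|x - y| <= 1 by near: y; apply: cvgr_dist_le.
  by rewrite ler_norml => /andP[xy1 _]; have := ler_norm x; lra.
have xx : x <= `|x| + 1 by have := ler_norm x; lra.
have le_e z : z <= e / M -> M * z <= e by rewrite ler_pdivlMr// mulrC.
have [ley|ltx] := leP x y.
  by rewrite distrC; apply: le_trans (lip _ _ ley yx) _; apply: le_e;
    rewrite distrC in xy; exact: le_trans (ler_norm _) xy.
by apply: le_trans (lip _ _ (ltW ltx) xx) _; apply: le_e; exact: le_trans (ler_norm _) xy.
Unshelve. all: by end_near.
Qed.

End Primitive.

(** * Order, Lipschitz and continuity properties of the reflection term *)

Section SkorohodHat.
Variables (R : realType) (a : R).
Implicit Types (f g : R -> R) (s t c e : R).

(** The condition c >= 0 accounts both for the positive part and for the default value 0 of the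
    supremum of the empty set when t < 0. *)
Lemma skorohod_hat_le f t c : 0 <= c ->
  (forall s, 0 <= s <= t -> f s - a <= c) -> skorohod_hat a f t <= c.
Proof.
move=> c0 fc; rewrite /skorohod_hat.
have [t0|t0] := leP 0 t; last first.
  by rewrite set_itv_ge ?image_set0 ?sup0// bnd_simp -ltNge.
apply: ge_sup; first by exists (Num.max (f 0 - a) 0); exists 0 => //=; rewrite in_itv/= lexx.
by move=> _ [s + <-]; rewrite /= in_itv/= => st; rewrite ge_max c0 fc.
Qed.

Lemma skorohod_hat_has_ub f t : continuous f ->
  has_ubound [set Num.max (f s - a) 0 | s in `[0, t]].
Proof.
move=> cf.
have := continuous_compact (continuous_subspaceT cf) (@segment_compact _ 0 t).
move=> /compact_bounded[M [_ bM]].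
exists (Num.max (`|M| + 1 - a) 0) => _ [s st <-].
rewrite ge_max !le_max lexx orbT andbT lerB//.
apply: le_trans (ler_norm _) _; apply: (bM (`|M| + 1)); last by exists s.
by rewrite (le_lt_trans (ler_norm M))// ltrDl.
Qed.

Lemma skorohod_hat_max_ge f s t : continuous f -> 0 <= s <= t ->
  Num.max (f s - a) 0 <= skorohod_hat a f t.
Proof.
move=> cf st; apply: ub_le_sup; first exact: skorohod_hat_has_ub.
by exists s => //=; rewrite in_itv.
Qed.

Lemma skorohod_hat_ge f s t : continuous f -> 0 <= s <= t ->
  f s - a <= skorohod_hat a f t.
Proof. by move=> cf /(skorohod_hat_max_ge cf); rewrite ge_max => /andP[]. Qed.

Lemma skorohod_hat_ge0 f t : continuous f -> 0 <= skorohod_hat a f t.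
Proof.
move=> cf; have [t0|t0] := leP 0 t.
  have : 0 <= t <= t by rewrite t0 lexx.
  by move=> /(skorohod_hat_max_ge cf); rewrite ge_max => /andP[].
by rewrite /skorohod_hat set_itv_ge ?image_set0 ?sup0// bnd_simp -ltNge.
Qed.

Lemma eq_skorohod_hat f g t : (forall s, 0 <= s <= t -> f s = g s) ->
  skorohod_hat a f t = skorohod_hat a g t.
Proof.
move=> fg; rewrite /skorohod_hat; congr sup; apply: eq_imagel => s /=.
by rewrite in_itv/= => /fg ->.
Qed.

Lemma skorohod_hat_homo f s t : continuous f -> s <= t ->
  skorohod_hat a f s <= skorohod_hat a f t.
Proof.
move=> cf st; apply: skorohod_hat_le; first exact: skorohod_hat_ge0.
by move=> u /andP[u0 us]; apply: skorohod_hat_ge; rewrite ?u0 ?(le_trans us).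
Qed.

Lemma skorohod_hat_npos f t : continuous f -> f 0 <= a -> t <= 0 ->
  skorohod_hat a f t = 0.
Proof.
move=> cf f0 t0; apply/eqP; rewrite eq_le skorohod_hat_ge0// andbT.
apply: skorohod_hat_le => // s /andP[s0 st].
by rewrite (@le_anti _ _ s 0) ?subr_le0// s0 (le_trans st).
Qed.

Lemma skorohod_hat_lip f g t e : continuous f -> continuous g -> 0 <= e ->
  (forall s, 0 <= s <= t -> `|f s - g s| <= e) ->
  `|skorohod_hat a f t - skorohod_hat a g t| <= e.
Proof.
move=> cf cg e0 fg; rewrite ler_distl; apply/andP; split.
  rewrite lerBlDr; apply: skorohod_hat_le; first by rewrite addr_ge0// skorohod_hat_ge0.
  move=> s st; have := skorohod_hat_ge cf st.
  by have := fg _ st; rewrite ler_norml => /andP[]; lra.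
apply: skorohod_hat_le; first by rewrite addr_ge0// skorohod_hat_ge0.
move=> s st; have := skorohod_hat_ge cg st.
by have := fg _ st; rewrite ler_norml => /andP[]; lra.
Qed.

(** A value of f - a taken after s exceeds f s - a by at most e, and f s - a is already counted at
    time s. If s < 0, time 0 replaces s and [f 0 <= a] is used. *)
Lemma skorohod_hat_osc f s t e : continuous f -> f 0 <= a -> 0 <= e ->
  (forall u w, s <= u <= t -> s <= w <= t -> f u <= f w + e) ->
  s <= t -> skorohod_hat a f t <= skorohod_hat a f s + e.
Proof.
move=> cf f0 e0 fe st; apply: skorohod_hat_le.
  by rewrite addr_ge0// skorohod_hat_ge0.
move=> u /andP[u0 ut].
have [us|su] := leP u s.
  have : 0 <= u <= s by rewrite u0.
  by move=> /(skorohod_hat_ge cf); lra.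
have uI : s <= u <= t by rewrite ut ltW.
have [s0|s0] := leP 0 s.
  have : 0 <= s <= s by rewrite s0 lexx.
  move=> /(skorohod_hat_ge cf).
  by have := fe u s uI; rewrite lexx st => /(_ isT); lra.
have := skorohod_hat_ge0 s cf.
by have := fe u 0 uI; rewrite (ltW s0) (le_trans u0 ut) => /(_ isT); lra.
Qed.

Lemma skorohod_hat_continuous f : continuous f -> f 0 <= a ->
  continuous (skorohod_hat a f).
Proof.
move=> cf f0 /= x; apply/cvgrPdist_le => /= e e0.
have /cvgrPdist_le/(_ (e / 2) (divr_gt0 e0 (ltr0n _ 2)))/nbhs_ballP[d/= d0 xd] := cf x.
near=> y.
have xy : `|x - y| < d by near: y; apply: cvgr_dist_lt.
have fe u w : `|x - u| <= `|x - y| -> `|x - w| <= `|x - y| -> f u <= f w + e.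
  move=> xu xw.
  have := xd u (le_lt_trans xu xy); rewrite /= ler_norml => /andP[].
  have := xd w (le_lt_trans xw xy); rewrite /= ler_norml => /andP[].
  by lra.
have [lexy|/ltW leyx] := leP x y.
  rewrite distrC ger0_norm ?subr_ge0 ?skorohod_hat_homo//.
  rewrite lerBlDl; apply: skorohod_hat_osc => //; first exact: ltW.
  by move=> u w uI wI; apply: fe; rewrite !(distrC x) !ger0_norm; lra.
rewrite ger0_norm ?subr_ge0 ?skorohod_hat_homo//.
rewrite lerBlDl; apply: skorohod_hat_osc => //; first exact: ltW.
by move=> u w uI wI; apply: fe; rewrite !ger0_norm; lra.
Unshelve. all: by end_near.
Qed.

(** Suppose the supremum grew on [s, t], and let u maximise f there. Then f u - a is at least the
    running supremum at u, so the reflected path is at least a at u, which is excluded for u > s. If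
    u = s, no later value exceeds f s and there is no growth. *)
Lemma skorohod_hat_flat f s t : continuous f -> 0 <= s <= t ->
  (forall u, s < u <= t -> skorohod a f u < a) ->
  skorohod_hat a f t = skorohod_hat a f s.
Proof.
move=> cf /andP[s0 st] ga; apply/eqP; rewrite eq_le (skorohod_hat_homo cf st) andbT leNgt.
apply/negP => lt_hat.
have [u /[!in_itv]/= /andP[su ut] maxu] := EVT_max st (continuous_subspaceT cf).
have hu : skorohod_hat a f u <= f u - a.
  have hs0 := skorohod_hat_ge0 s cf.
  have H : skorohod_hat a f t <= Num.max (skorohod_hat a f s) (f u - a).
    apply: skorohod_hat_le; first by rewrite le_max hs0.
    move=> w /andP[w0 wt]; rewrite le_max.
    have [ws|sw] := leP w s; first by rewrite skorohod_hat_ge// w0.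
    by rewrite lerB ?orbT// maxu// in_itv/= wt ltW.
  apply: (le_trans (skorohod_hat_homo cf ut)).
  by move: H; rewrite le_max => /orP[|//]; rewrite leNgt lt_hat.
move: su; rewrite le_eqVlt => /predU1P[su|su].
  have : skorohod_hat a f t <= skorohod_hat a f s.
    apply: skorohod_hat_le; first exact: skorohod_hat_ge0.
    move=> w /andP[w0 wt].
    have [ws|sw] := leP w s; first by rewrite skorohod_hat_ge// w0.
    have : f w <= f u by rewrite maxu// in_itv/= wt ltW.
    have : f s - a <= skorohod_hat a f s by apply: skorohod_hat_ge; rewrite // s0 lexx.
    by rewrite -su; lra.
  by rewrite leNgt lt_hat.
by have := ga u; rewrite su ut /skorohod => /(_ isT); lra.
Qed.

End SkorohodHat.

(** * The Picard map, its weighted contraction estimate, and uniqueness of fixed points *)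

Section Picard.
Variables (R : realType) (lambda : R) (r : nat -> R).
Implicit Types (g : R -> nat -> R) (s t T C : R).

Definition coordwise_continuous g := forall n, continuous (fun t => g t n).

(* The path v_(n+1) obtained from g alone by unwinding the recursion on v_n. *)
Fixpoint reflection g (n : nat) : R -> R :=
  skorohod_hat 1 (fun t => r n - prim (fun s => g s n - g s n.+1) t +
    (if n is m.+1 then reflection g m t else lambda * t)).

Definition input g : nat -> R -> R :=
  sys_input lambda r g (fun t n => reflection g n t).

Lemma reflectionE g n : reflection g n = skorohod_hat 1 (input g n).
Proof. by case: n. Qed.

Lemma inputE g n t : input g n t = r n - prim (fun s => g s n - g s n.+1) t +
  v_prev lambda (fun t n => reflection g n t) n t.
Proof. by []. Qed.

(* Freezing the path at its value at 0 for t < 0 makes it continuous on all of R. *)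
Definition picard_map g : R -> nat -> R :=
  fun t n => skorohod 1 (input g n) (Num.max t 0).

Lemma picard_mapE g n t : 0 <= t ->
  picard_map g t n = input g n t - reflection g n t.
Proof. by move=> t0; rewrite /picard_map /skorohod reflectionE max_l. Qed.

Hypothesis r_le1 : forall n, r n <= 1.

Lemma flux_continuous g n : coordwise_continuous g ->
  continuous (fun s => g s n - g s n.+1).
Proof. by move=> cg x; apply: cvgB; exact: cg. Qed.

(** The two facts go through one induction: the next input contains [reflection g n], whose
    continuity requires that the n-th input start at r n <= 1. *)
Lemma input_continuous0 g n : coordwise_continuous g ->
  continuous (input g n) /\ input g n 0 = r n.
Proof.
move=> cg; have cP m : continuous (prim (fun s => g s m - g s m.+1)).
  by apply: prim_continuous; exact: flux_continuous.
elim: n => [|n [IHc IH0]]; split.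
- move=> x; apply: cvgD; first apply: cvgB; first exact: cvg_cst.
    exact: cP.
  by apply: cvgM; [exact: cvg_cst|exact: cvg_id].
- by rewrite inputE prim_npos// subr0 /= mulr0 addr0.
- move=> x; apply: cvgD; first apply: cvgB; first exact: cvg_cst.
    exact: cP.
  have cR : continuous (reflection g n).
    by rewrite reflectionE; apply: skorohod_hat_continuous; rewrite ?IH0.
  exact: cR.
- by rewrite inputE prim_npos// subr0 /v_prev reflectionE skorohod_hat_npos ?IH0// addr0.
Qed.

Lemma input_continuous g n : coordwise_continuous g -> continuous (input g n).
Proof. by move=> /(input_continuous0 n)[]. Qed.

Lemma input_at0 g n : coordwise_continuous g -> input g n 0 = r n.
Proof. by move=> /(input_continuous0 n)[]. Qed.

Lemma reflection_continuous g n : coordwise_continuous g -> continuous (reflection g n).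
Proof.
move=> cg; rewrite reflectionE; apply: skorohod_hat_continuous.
  exact: input_continuous.
by rewrite input_at0.
Qed.

Lemma reflection_npos g n t : coordwise_continuous g -> t <= 0 -> reflection g n t = 0.
Proof.
move=> cg t0; rewrite reflectionE skorohod_hat_npos ?input_at0//.
exact: input_continuous.
Qed.

Lemma reflection_ge0 g n t : coordwise_continuous g -> 0 <= reflection g n t.
Proof.
by move=> cg; rewrite reflectionE skorohod_hat_ge0//; exact: input_continuous.
Qed.

Lemma max0_continuous : continuous (fun t : R => Num.max t 0).
Proof. by move=> x; apply: continuous_max; [exact: cvg_id|exact: cvg_cst]. Qed.

Lemma picard_map_continuous g : coordwise_continuous g -> coordwise_continuous (picard_map g).
Proof.
move=> cg n.
have cS : continuous (skorohod 1 (input g n)).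
  move=> x; apply: cvgB; first exact: input_continuous.
  by rewrite -reflectionE; exact: reflection_continuous.
move=> x; apply: (@continuous_comp _ _ _ (fun t : R => Num.max t 0)).
  exact: max0_continuous.
exact: cS.
Qed.

(* Errors accumulate along v_1, ..., v_n; the weights 2^n absorb the resulting
   sum of the 2^j for j <= n. *)
Lemma reflection_contraction g h T C k :
    coordwise_continuous g -> coordwise_continuous h -> 0 <= C ->
    (forall n t, 0 <= t <= T -> `|g t n - h t n| <= 2 ^+ n * C * t ^+ k) ->
  forall n t, 0 <= t <= T ->
    `|input g n t - input h n t| <= 6 * 2 ^+ n * (C / k.+1%:R) * t ^+ k.+1 /\
    `|reflection g n t - reflection h n t| <= 6 * 2 ^+ n * (C / k.+1%:R) * t ^+ k.+1.
Proof.
move=> cg ch C0 gh.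
pose K t := C / k.+1%:R * t ^+ k.+1.
have K_le s t : 0 <= s -> s <= t -> K s <= K t.
  by move=> s0 st; rewrite ler_wpM2l ?divr_ge0// lerXn2r// nnegrE (le_trans s0).
have flux_le n t : 0 <= t <= T ->
    `|prim (fun s => g s n - g s n.+1) t - prim (fun s => h s n - h s n.+1) t|
      <= 3 * 2 ^+ n * K t.
  move=> /andP[t0 tT]; rewrite -primB; try exact: flux_continuous.
  (* The factor 3 * 2^n is 2^n + 2^(n+1), the weights of the two coordinates in the flux. *)
  have -> : 3 * 2 ^+ n * K t = prim (fun s => (3 * 2 ^+ n * C) * s ^+ k) t.
    rewrite primZ ?prim_exprn//; last exact: exprn_continuous.
    by rewrite /K; ring.
  apply: prim_norm_le => //.
  - by move=> x; apply: cvgB; exact: flux_continuous.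
  - by move=> x; apply: cvgM; [exact: cvg_cst|exact: exprn_continuous].
  - move=> s /andP[s0 st]; have sT : 0 <= s <= T by rewrite s0 (le_trans st).
    have := gh n s sT; have := gh n.+1 s sT.
    rewrite exprS !ler_norml => /andP[? ?] /andP[? ?]; apply/andP; split; lra.
(* The flux contributes 3 * 2^n; for n > 0 the preceding reflection contributes 6 * 2^(n-1), which
   is again 3 * 2^n. *)
have step n t : 0 <= t <= T ->
    `|v_prev lambda (fun t n => reflection g n t) n t
      - v_prev lambda (fun t n => reflection h n t) n t| <= 3 * 2 ^+ n * K t ->
    `|input g n t - input h n t| <= 6 * 2 ^+ n * K t.
  move=> tT; have := flux_le n t tT; rewrite !inputE.
  by rewrite !ler_norml => /andP[? ?] /andP[? ?]; apply/andP; split; lra.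
have refl n t : 0 <= t <= T ->
    (forall s, 0 <= s <= T -> `|input g n s - input h n s| <= 6 * 2 ^+ n * K s) ->
    `|reflection g n t - reflection h n t| <= 6 * 2 ^+ n * K t.
  move=> /andP[t0 tT] H; have Kt : 0 <= K t by rewrite /K !mulr_ge0 ?exprn_ge0.
  rewrite !reflectionE; apply: skorohod_hat_lip; try exact: input_continuous.
    by rewrite !mulr_ge0// exprn_ge0.
  move=> s /andP[s0 st]; apply: le_trans (H s _) _; first by rewrite s0 (le_trans st).
  by rewrite ler_wpM2l ?K_le// mulr_ge0// exprn_ge0.
have main n : forall t, 0 <= t <= T ->
    `|input g n t - input h n t| <= 6 * 2 ^+ n * K t.
  elim: n => [|n IH] t tT; apply: step => //.
    case/andP: (tT) => t0 _.
    by rewrite subrr normr0 !mulr_ge0 ?exprn_ge0.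
  have -> : 3 * 2 ^+ n.+1 * K t = 6 * 2 ^+ n * K t by rewrite exprS; ring.
  exact: refl.
move=> n t tT; rewrite -mulrA -/(K t); split; first exact: main.
by apply: refl => //; exact: main.
Qed.

Lemma picard_map_contraction g h T C k :
    coordwise_continuous g -> coordwise_continuous h -> 0 <= C ->
    (forall n t, 0 <= t <= T -> `|g t n - h t n| <= 2 ^+ n * C * t ^+ k) ->
  forall n t, 0 <= t <= T ->
    `|picard_map g t n - picard_map h t n|
      <= 2 ^+ n * (12 * C / k.+1%:R) * t ^+ k.+1.
Proof.
move=> cg ch C0 gh n t tT; have /andP[t0 _] := tT.
have [] := reflection_contraction cg ch C0 gh n tT.
rewrite !picard_mapE//.
(* The constant 12 is 6 for the input plus 6 for the reflection subtracted from it. *)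
set X := _ * t ^+ _; have -> : 2 ^+ n * (12 * C / k.+1%:R) * t ^+ k.+1 = 2 * X.
  by rewrite /X; ring.
by rewrite !ler_norml => /andP[? ?] /andP[? ?]; apply/andP; split; lra.
Qed.

(** This is C * 12^k / k!, the constant left after k uses of the contraction estimate; with the
    factor T^k it becomes a term of the series of exp(12 T). *)
Fixpoint iter_const C k : R :=
  if k is k'.+1 then 12 * iter_const C k' / k'.+1%:R else C.

Lemma iter_constE C T k : iter_const C k * T ^+ k = C * exp_coeff (12 * T) k.
Proof.
rewrite exp_coeffE.
elim: k => [|k IH] /=; first by rewrite !expr0 fact0 invr1 !mulr1.
rewrite factS natrM invfM exprS.
have -> : 12 * iter_const C k / k.+1%:R * (T * T ^+ k) =
  12 * T / k.+1%:R * (iter_const C k * T ^+ k) by ring.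
by rewrite IH exprS; ring.
Qed.

Lemma iter_const_ge0 C k : 0 <= C -> 0 <= iter_const C k.
Proof. by move=> C0; elim: k => //= k IH; rewrite divr_ge0 ?mulr_ge0. Qed.

(** Feeding the a priori bound k times through [picard_map_contraction] gives 2^n * C * (12 t)^k /
    k!, which tends to 0 as k grows. *)
Lemma picard_fixed_point_unique g h T C :
    coordwise_continuous g -> coordwise_continuous h -> 0 <= C ->
    (forall n t, 0 <= t <= T -> g t n = picard_map g t n) ->
    (forall n t, 0 <= t <= T -> h t n = picard_map h t n) ->
    (forall n t, 0 <= t <= T -> `|g t n - h t n| <= 2 ^+ n * C) ->
  forall n t, 0 <= t <= T -> g t n = h t n.
Proof.
move=> cg ch C0 fg fh gh n t tT; have /andP[t0 _] := tT.
have bnd k m u : 0 <= u <= T ->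
    `|g u m - h u m| <= 2 ^+ m * iter_const C k * u ^+ k.
  elim: k m u => [|k IH] m u uT; first by rewrite expr0 mulr1 gh.
  rewrite fg// fh//=; apply: picard_map_contraction uT => //.
  exact: iter_const_ge0.
apply/eqP; rewrite -subr_eq0 -normr_le0.
have lim0 : 2 ^+ n * C * exp_coeff (12 * t) k @[k --> \oo] --> (0 : R).
  by rewrite -[X in _ --> X](mulr0 (2 ^+ n * C)); apply: cvgM;
    [exact: cvg_cst|exact: cvg_exp_coeff].
rewrite -(cvg_lim _ lim0)//; apply: limr_ge; first by apply/cvg_ex; eexists; exact: lim0.
by apply: nearW => k; rewrite -mulrA -iter_constE mulrA bnd.
Qed.

End Picard.

(** The increments of u are absolutely summable by comparison with the telescoping series of S.
    Adding them from k to k + m and letting m tend to infinity gives the error bound. *)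
Lemma cvg_dominated_increments (R : realType) (u S : nat -> R) :
  (forall k, `|u k.+1 - u k| <= S k.+1 - S k) -> cvgn S ->
  cvgn u /\ forall k, `|limn u - u k| <= limn S - S k.
Proof.
move=> uS cS.
have cu : cvgn u.
  have cT : cvgn (series (telescope S)).
    rewrite telescopeK; apply: (@is_cvgB _ _ _ _ _ S (fun=> S 0%N)) cS _.
    exact: is_cvg_cst.
  have -> : u = (fun k => u 0%N + series (telescope u) k).
    by apply/funext => k; exact: eq_sum_telescope.
  apply: (@is_cvgD _ _ _ _ _ (fun=> u 0%N)); first exact: is_cvg_cst.
  apply: normed_cvg; apply: (series_le_cvg _ _ _ cT) => [k|k|k] //=.
    exact: le_trans (uS k).
  exact: uS.
split=> // k.
have inc m : `|u (k + m)%N - u k| <= S (k + m)%N - S k.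
  elim: m => [|m IH]; first by rewrite addn0 !subrr normr0.
  rewrite addnS; have := uS (k + m)%N; move: IH.
  by rewrite !ler_norml => /andP[? ?] /andP[? ?]; apply/andP; split; lra.
have cl : `|u m - u k| @[m --> \oo] --> `|limn u - u k|.
  by apply: cvg_norm; apply: cvgB => //; exact: cvg_cst.
have cr : S m - S k @[m --> \oo] --> limn S - S k.
  by apply: cvgB => //; exact: cvg_cst.
rewrite -(cvg_lim _ cl)// -(cvg_lim _ cr)//; apply: ler_lim.
- by apply/cvg_ex; eexists; exact: cl.
- by apply/cvg_ex; eexists; exact: cr.
- by near=> m; rewrite -(@subnKC k m)//; near: m; exact: nbhs_infty_ge.
Unshelve. all: by end_near.
Qed.

(** * Convergence of the Picard iteration to a fixed point *)

Section PicardLimit.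
Variables (R : realType) (lambda : R) (r : nat -> R).
Hypothesis lambda_ge0 : 0 <= lambda.
Hypothesis r01 : forall n, 0 <= r n <= 1.
Implicit Types (g : R -> nat -> R) (s t T C : R).

Let r_le1 n : r n <= 1. Proof. by case/andP: (r01 n). Qed.

Let zero_path : R -> nat -> R := fun _ _ => 0.

Let zero_path_continuous : coordwise_continuous zero_path.
Proof. by move=> n x; exact: cvg_cst. Qed.

Definition picard_iter k : R -> nat -> R := iter k (picard_map lambda r) zero_path.

Lemma picard_iter_continuous k : coordwise_continuous (picard_iter k).
Proof.
by elim: k => [|k IH]; [exact: zero_path_continuous|exact: picard_map_continuous].
Qed.

(** For the zero path the flux vanishes, and since r <= 1 the bound 2^m * (1 + lambda T) on the
    feeding terms propagates in m. The outer factor 2 comes from the subtracted reflection, whose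
    weight is 2^(n+1). *)
Lemma picard_iter1_le T n t : 0 <= t <= T ->
  `|picard_iter 1 t n| <= 2 ^+ n * (2 * (1 + lambda * T)).
Proof.
move=> /andP[t0 tT].
have T0 : 0 <= T by exact: le_trans tT.
have lT : 0 <= lambda * T by rewrite mulr_ge0.
have input0 m s : 0 <= s -> input lambda r zero_path m s =
    r m + v_prev lambda (fun t n => reflection lambda r zero_path n t) m s.
  move=> s0; rewrite inputE (_ : prim _ s = 0) ?subr0//.
  by rewrite (prim_cst (0 - 0) s0) subrr mul0r.
have prev_le m s : 0 <= s <= T ->
    0 <= v_prev lambda (fun t n => reflection lambda r zero_path n t) m s
      <= 2 ^+ m * (1 + lambda * T).
  elim: m s => [|m IH] s /andP[s0 sT] /=.
    by rewrite expr0 mul1r mulr_ge0//= ler_wpDl// ler_wpM2l.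
  rewrite reflection_ge0//= reflectionE; apply: skorohod_hat_le.
    by rewrite mulr_ge0 ?exprn_ge0// addr_ge0.
  move=> u /andP[u0 us]; rewrite input0//.
  have /IH/andP[_] : 0 <= u <= T by rewrite u0 (le_trans us).
  have := r_le1 m.
  have : 2 ^+ m * (1 + lambda * T) <= 2 ^+ m.+1 * (1 + lambda * T).
    by rewrite ler_wpM2r ?addr_ge0// exprS ler_peMl ?exprn_ge0// ler1n.
  by lra.
rewrite /picard_iter /= picard_mapE// input0//.
have tI : 0 <= t <= T by rewrite t0.
have /andP[p0 p1] := prev_le n t tI.
have := prev_le n.+1 t tI; rewrite [X in _ <= X <= _]/= exprS => /andP[q0 q1].
have /andP[rn0 rn1] := r01 n.
have one_le : 1 <= 2 ^+ n * (1 + lambda * T).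
  by rewrite -[leLHS]mul1r ler_pM ?exprn_ege1 ?ler1n ?lerDl.
by rewrite ler_norml; apply/andP; split; lra.
Qed.

(** The tail of the series of exp(12 T), scaled by the bound on the first iterate. *)
Definition picard_error T k : R := 2 * (1 + lambda * T) *
  (limn (series (exp_coeff (12 * T))) - series (exp_coeff (12 * T)) k).

Lemma picard_error_cvg0 T : picard_error T k @[k --> \oo] --> 0.
Proof.
rewrite -[X in _ --> X](mulr0 (2 * (1 + lambda * T))).
apply: cvgM; first exact: cvg_cst.
rewrite -[X in _ --> X](subrr (limn (series (exp_coeff (12 * T))))).
by apply: cvgB; [exact: cvg_cst|exact: is_cvg_series_exp_coeff].
Qed.

Definition picard_lim t n : R := limn (fun k => picard_iter k (Num.max t 0) n).

Lemma picard_lim_error T k n t : 0 <= t <= T ->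
  `|picard_lim t n - picard_iter k t n| <= 2 ^+ n * picard_error T k.
Proof.
move=> /andP[t0 tT]; rewrite /picard_lim max_l//.
have T0 : 0 <= T by exact: le_trans tT.
have A0 : 0 <= 2 * (1 + lambda * T) by rewrite mulr_ge0// addr_ge0// mulr_ge0.
have inc j m u : 0 <= u <= T -> `|picard_iter j.+1 u m - picard_iter j u m| <=
    2 ^+ m * iter_const (2 * (1 + lambda * T)) j * u ^+ j.
  elim: j m u => [|j IH] m u uT.
    by rewrite expr0 mulr1 subr0; exact: picard_iter1_le.
  rewrite [picard_iter j.+2]/picard_iter [picard_iter j.+1]/picard_iter !iterS.
  apply: (@picard_map_contraction _ lambda r r_le1 (picard_iter j.+1) (picard_iter j) T
    (iter_const (2 * (1 + lambda * T)) j) j) => //; try exact: picard_iter_continuous.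
  exact: iter_const_ge0.
(* The increments of S are the bounds [inc] with t replaced by T, rewritten by [iter_constE]. *)
pose S := fun j => 2 ^+ n * (2 * (1 + lambda * T)) * series (exp_coeff (12 * T)) j.
have cS : S j @[j --> \oo] -->
    2 ^+ n * (2 * (1 + lambda * T)) * limn (series (exp_coeff (12 * T))).
  by apply: cvgM; [exact: cvg_cst|exact: is_cvg_series_exp_coeff].
have iS j : `|picard_iter j.+1 t n - picard_iter j t n| <= S j.+1 - S j.
  rewrite /S -mulrBr seriesSB -mulrA -iter_constE mulrA.
  apply: le_trans (inc j n t _) _; first by rewrite t0.
  rewrite ler_wpM2l// ?mulr_ge0 ?exprn_ge0 ?iter_const_ge0//.
  by rewrite lerXn2r// nnegrE.
have cvS : cvgn S by apply/cvg_ex; eexists; exact: cS.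
have [_ /(_ k)] := @cvg_dominated_increments _ (fun k => picard_iter k t n) S iS cvS.
have -> : limn S - S k = 2 ^+ n * picard_error T k.
  by rewrite (cvg_lim _ cS)// /S /picard_error; ring.
by [].
Qed.

(** Each coordinate converges uniformly on [0, |x| + 1], so one continuous iterate within e / 3 of
    the limit suffices. *)
Lemma picard_lim_continuous : coordwise_continuous picard_lim.
Proof.
move=> n /= x; apply/cvgrPdist_le => /= e e0.
pose T := `|x| + 1.
have cE : 2 ^+ n * picard_error T k @[k --> \oo] --> 0.
  rewrite -[X in _ --> X](mulr0 (2 ^+ n)).
  by apply: cvgM; [exact: cvg_cst|exact: picard_error_cvg0].
have e3 : 0 < e / 3 by rewrite divr_gt0.
have /cvgrPdist_le/(_ _ e3)[k _ /(_ k (leqnn k))/=] := cE.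
rewrite sub0r normrN => ke.
have cK : continuous (fun t => picard_iter k (Num.max t 0) n).
  move=> y; apply: (@continuous_comp _ _ _ (fun t : R => Num.max t 0)
    (fun t => picard_iter k t n)).
    exact: max0_continuous.
  exact: picard_iter_continuous.
have max_lim y : picard_lim y n = picard_lim (Num.max y 0) n.
  by rewrite /picard_lim (max_l _ : Num.max (Num.max y 0) 0 = Num.max y 0)// le_max lexx orbT.
near=> y.
have yT : 0 <= Num.max y 0 <= T.
  have : `|x - y| <= 1 by near: y; apply: cvgr_dist_le.
  rewrite ler_norml le_max lexx orbT ge_max addr_ge0//= andbT.
  by move=> /andP[? _]; rewrite /T; have := ler_norm x; lra.
have xT : 0 <= Num.max x 0 <= T.
  rewrite le_max lexx orbT ge_max addr_ge0//= andbT.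
  by rewrite /T; have := ler_norm x; lra.
have xy : `|picard_iter k (Num.max x 0) n - picard_iter k (Num.max y 0) n| <= e / 3.
  by near: y; move: (cK x) => /cvgrPdist_le; exact.
have := le_trans (picard_lim_error k n xT) (le_trans (ler_norm _) ke).
have := le_trans (picard_lim_error k n yT) (le_trans (ler_norm _) ke).
rewrite (max_lim x) (max_lim y); move: xy.
by rewrite !ler_norml => /andP[? ?] /andP[? ?] /andP[? ?]; apply/andP; split; lra.
Unshelve. all: by end_near.
Qed.

Lemma picard_lim_fixed t n : 0 <= t ->
  picard_lim t n = picard_map lambda r picard_lim t n.
Proof.
move=> t0; apply/eqP; rewrite -subr_eq0 -normr_le0.
have tt : 0 <= t <= t by rewrite t0 lexx.
have E0 k : 0 <= picard_error t k.
  by have := le_trans (normr_ge0 _) (picard_lim_error k 0 tt); rewrite expr0 mul1r.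
(* Iterate k + 1 is inserted between the two sides. Its distance to the image of the limit comes
   from the contraction estimate, started from a constant majorant, that is with exponent 0. *)
have bnd k : `|picard_lim t n - picard_map lambda r picard_lim t n| <=
    2 ^+ n * picard_error t k.+1 + 2 ^+ n * (12 * t) * picard_error t k.
  have err0 m u : 0 <= u <= t ->
      `|picard_lim u m - picard_iter k u m| <= 2 ^+ m * picard_error t k * u ^+ 0.
    by move=> uT; rewrite expr0 mulr1 picard_lim_error.
  have := picard_lim_error k.+1 n tt.
  have := @picard_map_contraction _ lambda r r_le1 picard_lim (picard_iter k) t
    (picard_error t k) 0 picard_lim_continuous (@picard_iter_continuous k) (E0 k).
  move=> /(_ err0 n t tt).
  rewrite -[picard_map _ _ (picard_iter k)]/(picard_iter k.+1).
  rewrite divr1 expr1 !ler_norml => /andP[? ?] /andP[? ?]; apply/andP; split; lra.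
have cE : 2 ^+ n * picard_error t k.+1 + 2 ^+ n * (12 * t) * picard_error t k
    @[k --> \oo] --> 0.
  rewrite -[X in _ --> X](_ : 2 ^+ n * 0 + 2 ^+ n * (12 * t) * 0 = 0); last by rewrite !mulr0 addr0.
  apply: cvgD; apply: cvgM; try exact: cvg_cst; last exact: picard_error_cvg0.
  by rewrite (cvg_shiftS (picard_error t)); exact: picard_error_cvg0.
rewrite -(cvg_lim _ cE)//; apply: limr_ge; first by apply/cvg_ex; eexists; exact: cE.
exact: nearW.
Qed.

End PicardLimit.

(** * A comparison principle for nonnegativity *)

Section Comparison.
Variable R : realType.

(** The times in [0, t] where y >= 0 form a compact set containing 0, hence have a largest
    element. *)
Lemma last_nonneg (y : R -> R) t : continuous y -> 0 <= t -> 0 <= y 0 ->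
  exists s, [/\ 0 <= s <= t, 0 <= y s & forall u, s < u <= t -> y u < 0].
Proof.
move=> cy t0 y0.
pose A := `[0, t] `&` y @^-1` [set z | 0 <= z].
have cptA : compact A.
  apply: compact_closedI; first exact: segment_compact.
  by apply: closed_comp => [x _|]; [exact: cy|exact: closed_ge].
have A0 : A !=set0 by exists 0; split => //=; rewrite in_itv/= lexx.
have cid : {within A, continuous (@idfun R)}.
  by apply: continuous_subspaceT => x; exact: cvg_id.
have [s /set_mem[/= sI ys] smax] := compact_EVT_max A0 cptA cid.
exists s; split=> //.
move=> u /andP[su ut]; rewrite ltNge; apply/negP => yu.
have : u \in A.
  rewrite inE; split=> //=; rewrite in_itv/= ut andbT.
  by move: sI; rewrite in_itv/= => /andP[s0 _]; rewrite (le_trans s0 (ltW su)).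
by move=> /smax /=; rewrite leNgt su.
Qed.

(* Starting from the last time before t at which x_n >= 0 gives
   x_n(t) >= - int_0^t (x_(n+1))^-, which is iterated with the weights 2^n. *)
Lemma nonneg_comparison (x : R -> nat -> R) T C : coordwise_continuous x -> 0 <= C ->
  (forall n, 0 <= x 0 n) ->
  (forall n t, 0 <= t <= T -> `|x t n| <= 2 ^+ n * C) ->
  (forall n s t, 0 <= s <= t -> t <= T -> (forall u, s < u <= t -> x u n < 0) ->
     x s n - (prim (x ^~ n) t - prim (x ^~ n) s)
       + (prim (x ^~ n.+1) t - prim (x ^~ n.+1) s) <= x t n) ->
  forall n t, 0 <= t <= T -> 0 <= x t n.
Proof.
move=> cx C0 x0 xC xstep n t tT; have /andP[t0 _] := tT.
have bnd k m u : 0 <= u <= T -> - (2 ^+ m * iter_const C k * u ^+ k) <= x u m.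
  elim: k m u => [|k IH] m u uT.
    by have := xC m u uT; rewrite expr0 mulr1 ler_norml => /andP[].
  have /andP[u0 uleT] := uT.
  have c0 := iter_const_ge0 k C0.
  have := @last_nonneg (x ^~ m) u (cx m) u0 (x0 m) => -[s [/andP[s0 su] xs xneg]].
  have su' : 0 <= s <= u by rewrite s0.
  have ck c : continuous (fun v : R => c * v ^+ k).
    by move=> v; apply: cvgM; [exact: cvg_cst|exact: exprn_continuous].
  have H1 : prim (x ^~ m) u - prim (x ^~ m) s <= 0.
    have := @prim_increment_le _ (x ^~ m) (fun=> 0) s u (cx m) (fun z => @cvg_cst _ _ _ _ _) s0 su.
    rewrite !prim_cst// !mul0r subr0; apply => v /xneg; exact: ltW.
  have H2 : - (2 ^+ m.+1 * iter_const C k) * (u ^+ k.+1 / k.+1%:R) <=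
      prim (x ^~ m.+1) u - prim (x ^~ m.+1) s.
    have := @prim_increment_le _ (fun v => - (2 ^+ m.+1 * iter_const C k) * v ^+ k)
      (x ^~ m.+1) s u (ck _) (cx _) s0 su.
    rewrite !primZ ?prim_exprn//; try exact: exprn_continuous.
    move=> H; apply: le_trans (H _); last first.
      move=> v /andP[sv vu]; rewrite mulNr; apply: IH.
      by rewrite (le_trans s0 (ltW sv)) (le_trans vu).
    (* The factor is nonpositive, so dropping s^(k+1) from the difference only lowers the bound. *)
    rewrite -mulrBr ler_wnM2l//; first by rewrite oppr_le0 mulr_ge0// exprn_ge0.
    by rewrite lerBlDr lerDl divr_ge0// exprn_ge0.
  apply: le_trans (xstep m s u su' uleT xneg).
  pose X := 2 ^+ m * iter_const C k * (u ^+ k.+1 / k.+1%:R).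
  have X0 : 0 <= X by rewrite !mulr_ge0// ?invr_ge0// exprn_ge0.
  have EX : - (2 ^+ m.+1 * iter_const C k) * (u ^+ k.+1 / k.+1%:R) = - (2 * X).
    by rewrite /X (exprS 2); ring.
  (* The integrals lose at most 2 * X; the larger 12 * X allows [iter_const] to be reused. *)
  have -> : 2 ^+ m * iter_const C k.+1 * u ^+ k.+1 = 12 * X by rewrite /X /=; ring.
  clearbody X; move: xs X0 H1 H2; rewrite EX {EX}.
  move: (prim _ u - _) (prim _ u - _) (x s m) X => a b c X' ? ? ? ?.
  by lra.
have lim0 : - (2 ^+ n * C * exp_coeff (12 * t) k) @[k --> \oo] --> (0 : R).
  rewrite -[X in _ --> X]oppr0 -[X in _ --> - X](mulr0 (2 ^+ n * C)).
  by apply: cvgN; apply: cvgM; [exact: cvg_cst|exact: cvg_exp_coeff].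
rewrite -(cvg_lim _ lim0)//; apply: limr_le; first by apply/cvg_ex; eexists; exact: lim0.
by apply: nearW => k; rewrite -mulrA -iter_constE mulrA bnd.
Qed.

End Comparison.

(** * Order properties and mass bounds of a fixed point *)

Section FixedPoint.
Variables (R : realType) (lambda : R) (r : nat -> R) (g : R -> nat -> R).
Hypothesis lambda_ge0 : 0 <= lambda.
Hypothesis r01 : forall n, 0 <= r n <= 1.
Hypothesis r_homo : forall n, r n.+1 <= r n.
Hypothesis cg : coordwise_continuous g.
Hypothesis g_fixed : forall t n, 0 <= t -> g t n = picard_map lambda r g t n.
Hypothesis g_bound : forall T, exists2 C, 0 <= C &
  forall n t, 0 <= t <= T -> `|g t n| <= 2 ^+ n * C.
Implicit Types s t T : R.

Let r_le1 n : r n <= 1. Proof. by case/andP: (r01 n). Qed.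

Local Notation V := (reflection lambda r g).
Local Notation V' := (v_prev lambda (fun t n => V n t)).

Let v_prevS n t : V' n.+1 t = V n t.
Proof. by []. Qed.

Lemma fixed_pointE t n : 0 <= t ->
  g t n = r n - (prim (g ^~ n) t - prim (g ^~ n.+1) t) + V' n t - V n t.
Proof.
move=> t0; rewrite g_fixed// picard_mapE// inputE primB//; exact: cg.
Qed.

Lemma fixed_point_at0 n : g 0 n = r n.
Proof. by rewrite g_fixed// picard_mapE// input_at0// reflection_npos// subr0. Qed.

Lemma fixed_point_le1 t n : 0 <= t -> g t n <= 1.
Proof.
move=> t0; rewrite g_fixed// picard_mapE// reflectionE.
have tt : 0 <= t <= t by rewrite t0 lexx.
by have := skorohod_hat_ge 1 (@input_continuous _ lambda r r_le1 g n cg) tt; lra.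
Qed.

(** A fixed point is its own reflected path, so [skorohod_hat_flat] applies to its input. *)
Lemma fixed_point_flat s t n : 0 <= s <= t ->
  (forall u, s < u <= t -> g u n < 1) -> V n t = V n s.
Proof.
move=> /andP[s0 st] gu; rewrite reflectionE; apply: skorohod_hat_flat.
- exact: input_continuous.
- by rewrite s0.
move=> u /andP[su ut]; have u0 : 0 <= u by rewrite (le_trans s0)// ltW.
have := gu u; rewrite su ut g_fixed// picard_mapE// => /(_ isT).
by rewrite /skorohod reflectionE.
Qed.

Lemma reflection_homo s t n : s <= t -> V n s <= V n t.
Proof.
by move=> st; rewrite reflectionE skorohod_hat_homo//; exact: input_continuous.
Qed.

Lemma v_prev_homo s t n : s <= t -> V' n s <= V' n t.
Proof. by case: n => [|n] st; [exact: ler_wpM2l|exact: reflection_homo]. Qed.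

Lemma v_prev_ge0 t n : 0 <= t -> 0 <= V' n t.
Proof. by case: n => [|n] t0; [exact: mulr_ge0|exact: reflection_ge0]. Qed.

Lemma fixed_point_ge0 t n : 0 <= t -> 0 <= g t n.
Proof.
move=> t0; have [C C0 gC] := g_bound t.
apply: (@nonneg_comparison _ g t C) => //; last by rewrite t0 lexx.
  by move=> m; rewrite fixed_point_at0; case/andP: (r01 m).
move=> m s u su ut gneg; have /andP[s0 su'] := su.
have u0 := le_trans s0 su'.
have flat : V m u = V m s.
  by apply: fixed_point_flat => // w /gneg/lt_le_trans; apply.
rewrite (fixed_pointE m u0) (fixed_pointE m s0) flat.
by have := v_prev_homo m su'; lra.
Qed.

(** The comparison principle is applied to g_n - g_(n+1). Where this is negative, g_n < g_(n+1) <=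
    1, so [V n] is flat, while the growth of [V' n] and of [V n.+1] both raise the difference. *)
Lemma fixed_point_homo t n : 0 <= t -> g t n.+1 <= g t n.
Proof.
move=> t0; rewrite -subr_ge0; have [C C0 gC] := g_bound t.
apply: (@nonneg_comparison _ (fun t n => g t n - g t n.+1) t (3 * C)) => //;
  last by rewrite t0 lexx.
- by move=> m; exact: flux_continuous.
- by rewrite mulr_ge0.
- by move=> m; rewrite !fixed_point_at0 subr_ge0.
- move=> m u ut; have := gC m u ut; have := gC m.+1 u ut.
  by rewrite exprS !ler_norml => /andP[? ?] /andP[? ?]; apply/andP; split; lra.
- move=> m s u su ut gneg; have /andP[s0 su'] := su.
  have u0 := le_trans s0 su'.
  have flat : V m u = V m s.
    apply: fixed_point_flat => // w wI; have := gneg w wI.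
    have w0 : 0 <= w by case/andP: wI => /ltW sw _; exact: le_trans sw.
    by have := fixed_point_le1 m.+1 w0; lra.
  rewrite !primB; try exact: cg.
  rewrite (fixed_pointE m u0) (fixed_pointE m s0).
  rewrite (fixed_pointE m.+1 u0) (fixed_pointE m.+1 s0) !v_prevS flat.
  have := v_prev_homo m su'; have := reflection_homo m.+1 su'.
  by lra.
Qed.

Lemma fixed_point_homo_le t m n : 0 <= t -> (m <= n)%N -> g t n <= g t m.
Proof.
move=> t0; elim: n => [|n IH]; first by rewrite leqn0 => /eqP ->.
rewrite leq_eqVlt => /predU1P[->//|/IH]; apply: le_trans.
exact: fixed_point_homo.
Qed.

(** Both the fluxes and the reflections telescope, leaving only boundary terms. *)
Lemma fixed_point_sum t m n : 0 <= t -> (m <= n)%N ->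
  \sum_(m <= j < n) g t j = \sum_(m <= j < n) r j
    - (prim (g ^~ m) t - prim (g ^~ n) t) + V' m t - V' n t.
Proof.
move=> t0; elim: n => [|n IH].
  by rewrite leqn0 => /eqP ->; rewrite !big_geq//; ring.
rewrite leq_eqVlt => /predU1P[->|mn]; first by rewrite !big_geq//; ring.
by rewrite v_prevS !big_nat_recr//= IH// (fixed_pointE n t0); ring.
Qed.

Lemma fixed_point_sum_le t m n : 0 <= t -> (m <= n)%N ->
  \sum_(m <= j < n) g t j <= \sum_(m <= j < n) r j + V' m t.
Proof.
move=> t0 mn; rewrite fixed_point_sum//.
have := v_prev_ge0 n t0.
have : prim (g ^~ n) t <= prim (g ^~ m) t.
  apply: prim_le => //; try exact: cg.
  by move=> u /andP[u0 _]; exact: fixed_point_homo_le.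
by lra.
Qed.

Variable rho : R.
Hypothesis r_sum : forall n, \sum_(0 <= j < n) r j <= rho.

Lemma fixed_point_sum0_le t n : 0 <= t ->
  \sum_(0 <= j < n) g t j <= rho + lambda * t.
Proof.
by move=> t0; apply: le_trans (fixed_point_sum_le t0 (leq0n n)) _; rewrite lerD2r.
Qed.

(** If g_n reached 1 at a time u <= T for some n >= N, monotonicity in n would make the first N
    coordinates at least 1, and their sum would exceed the mass bound rho + lambda T. So g_n stays
    below 1 after time 0 and its reflection keeps its initial value 0. *)
Lemma reflection_eventually0 T : 0 <= T ->
  exists N, forall n t, (N <= n)%N -> 0 <= t <= T -> V n t = 0.
Proof.
move=> T0; pose N := Num.bound `|rho + lambda * T|; exists N => n t Nn /andP[t0 tT].
rewrite -(@reflection_npos _ lambda r r_le1 g n 0 cg (lexx _)).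
apply: fixed_point_flat => [|u /andP[u0 ut]]; first by rewrite lexx.
rewrite ltNge; apply/negP => gu1.
have : N%:R <= \sum_(0 <= j < N) g u j.
  rewrite -[leLHS]mulr1 mulr_natl -[in leLHS](subn0 N) -sumr_const_nat.
  apply: ler_sum_nat => j /andP[_ jN]; apply: le_trans gu1 _.
  by apply: fixed_point_homo_le; [exact: ltW|exact: leq_trans (ltnW jN) Nn].
move=> /le_trans /(_ (fixed_point_sum0_le N (ltW u0))).
have : rho + lambda * T < N%:R.
  by apply: le_lt_trans (ler_norm _) (archi_boundP (normr_ge0 _)).
have : lambda * u <= lambda * T by rewrite ler_wpM2l// (le_trans ut).
by lra.
Qed.

End FixedPoint.

(** * Estimates for the norms of l_1 and l_oo *)

Section SequenceSpaces.
Variable R : realType.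
Implicit Types (x : nat -> R) (p : \bar R).

Lemma ellP p x : ell p x <-> (ell_norm p x < +oo)%E.
Proof.
rewrite /ell /= /Lfun; split; first by case/andP => _; rewrite inE.
move=> xoo; apply/andP; split; rewrite inE//.
Qed.

Lemma ell_norm_ge0 p x : (0 <= ell_norm p x)%E.
Proof. exact: Lnorm_ge0. Qed.

Lemma ell_norm1E x : ell_norm 1%E x = (\sum_(k <oo) (`|x k|)%:E)%E.
Proof. by rewrite /ell_norm Lnorm1 ge0_integral_count. Qed.

Lemma ell_norm1_le x (c : R) : (forall n, \sum_(0 <= j < n) `|x j| <= c) ->
  (ell_norm 1%E x <= c%:E)%E.
Proof.
move=> xc; rewrite ell_norm1E; apply: lime_le.
  by apply: is_cvg_nneseries => n _ _; rewrite lee_fin.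
by apply: nearW => n; rewrite sumEFin lee_fin.
Qed.

Lemma sum_le_ell_norm1 x n : ((\sum_(0 <= j < n) `|x j|)%:E <= ell_norm 1%E x)%E.
Proof.
rewrite ell_norm1E -sumEFin; apply: nneseries_lim_ge => k _ _.
by rewrite lee_fin.
Qed.

Lemma coord_le_ell_norm1 x n : ((`|x n|)%:E <= ell_norm 1%E x)%E.
Proof.
apply: le_trans (sum_le_ell_norm1 x n.+1); rewrite lee_fin big_nat_recr//=.
by rewrite lerDr sumr_ge0.
Qed.

Lemma ell_normoo_le x (c : R) : 0 <= c -> (forall n, `|x n| <= c) ->
  (ell_norm +oo%E x <= c%:E)%E.
Proof.
(* The norm is an essential supremum with default value 0 on a space of measure 0; that branch uses
   [0 <= c]. *)
move=> c0 xc; rewrite /ell_norm unlock; case: ifPn => _; last by rewrite lee_fin.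
by apply/ess_sup_inf.ess_supP; apply: nearW => n /=; rewrite lee_fin.
Qed.

(** Convergence in the extended reals amounts to eventual finiteness, obtained from e = 1, together
    with convergence of the finite parts. *)
Lemma cvg_ell_norm0 (T : Type) (F : set_system T) (FF : Filter F) p (f : T -> nat -> R) :
  (forall e : R, 0 < e -> \forall s \near F, (ell_norm p (f s) <= e%:E)%E) ->
  ell_norm p (f s) @[s --> F] --> 0%E.
Proof.
move=> fe; apply/fine_cvgP; split.
  near=> s; rewrite ge0_fin_numE ?ell_norm_ge0//.
  by apply: (@le_lt_trans _ _ 1%:E); rewrite ?ltry//; near: s; exact: fe.
apply/cvgrPdist_le => e e0; near=> s.
rewrite sub0r normrN /= ger0_norm ?fine_ge0 ?ell_norm_ge0//.
have se : (ell_norm p (f s) <= e%:E)%E by near: s; exact: fe.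
rewrite -lee_fin fineK// ge0_fin_numE ?ell_norm_ge0//.
by apply: le_lt_trans se _; rewrite ltry.
Unshelve. all: by end_near.
Qed.

End SequenceSpaces.

(** * Local facts about continuous real functions *)

Section RealFunctions.
Variable R : realType.
Implicit Types s t : R.

Lemma near_le_add1 t : \forall s \near nbhs t, s <= t + 1.
Proof.
by apply/nbhs_ballP; exists 1 => //= s; rewrite /ball/= ltr_norml => /andP[? _]; lra.
Qed.

Lemma near_sum_dist_le (f : nat -> R -> R) m t (e : R) : (forall n, continuous (f n)) -> 0 < e ->
  \forall s \near nbhs t, \sum_(0 <= j < m) `|f j s - f j t| <= e.
Proof.
move=> cf e0.
have cS : continuous (fun s => \sum_(0 <= j < m) `|f j s - f j t|).
  elim: m => [|m IH] x.
    by under eq_fun do rewrite big_nil; exact: cvg_cst.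
  under eq_fun do rewrite big_nat_recr//=.
  apply: (@cvgD _ _ _ _ _ (fun s => \sum_(0 <= j < m) `|f j s - f j t|)); first exact: IH.
  by apply: cvg_norm; apply: cvgB; [exact: cf|exact: cvg_cst].
have /cvgrPdist_le/(_ e e0) := cS t.
apply: filterS => s; rewrite [X in `|X - _|]big1 ?sub0r ?normrN.
  by move=> /(le_trans (ler_norm _)).
by move=> j _; rewrite subrr normr0.
Qed.

Lemma continuous_rcll (f : R -> R) : continuous f -> rcll f.
Proof.
move=> cf; split=> t _; first exact: cvg_at_right_filter (cf t).
by apply/cvg_ex; exists (f t); exact: cvg_at_left_filter (cf t).
Qed.

End RealFunctions.

(** * A fixed point solves the system in the required path spaces *)

Section FixedPointSolution.
Variables (R : realType) (lambda : R) (r : nat -> R) (g : R -> nat -> R).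
Hypothesis lambda_ge0 : 0 <= lambda.
Hypothesis hr : ell1_down r.
Hypothesis cg : coordwise_continuous g.
Hypothesis g_fixed : forall t n, 0 <= t -> g t n = picard_map lambda r g t n.
Hypothesis g_bound : forall T, exists2 C, 0 <= C &
  forall n t, 0 <= t <= T -> `|g t n| <= 2 ^+ n * C.
Implicit Types s t T : R.

Local Notation V := (reflection lambda r g).
Local Notation V' := (v_prev lambda (fun t n => V n t)).

Let r01 n : 0 <= r n <= 1. Proof. by case: hr. Qed.
Let r_le1 n : r n <= 1. Proof. by case/andP: (r01 n). Qed.
Let r_homo n : r n.+1 <= r n. Proof. by case: hr. Qed.

Let rho := fine (ell_norm 1%E r).

Let r_sum n : \sum_(0 <= j < n) r j <= rho.
Proof.
have [/ellP roo _ _] := hr.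
rewrite -lee_fin fineK ?ge0_fin_numE ?ell_norm_ge0//.
apply: le_trans (sum_le_ell_norm1 r n); rewrite lee_fin.
by apply: ler_sum => j _; exact: ler_norm.
Qed.

Let eventually0 := reflection_eventually0 lambda_ge0 r01 r_homo cg g_fixed g_bound r_sum.

Lemma fixed_point_ell1_down t : 0 <= t -> ell1_down (g t).
Proof.
move=> t0; split.
- apply/ellP; apply: (@le_lt_trans _ _ (rho + lambda * t)%:E); last by rewrite ltry.
  apply: ell_norm1_le => n.
  rewrite (eq_bigr (g t)) => [|j _].
    exact: (fixed_point_sum0_le lambda_ge0 r01 r_homo cg g_fixed g_bound).
  by rewrite ger0_norm//; exact: (fixed_point_ge0 lambda_ge0 r01 cg g_fixed g_bound).
- by move=> n; exact: (fixed_point_homo lambda_ge0 r01 r_homo cg g_fixed g_bound).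
- move=> n; rewrite (fixed_point_ge0 lambda_ge0 r01 cg g_fixed g_bound)//=.
  exact: (fixed_point_le1 r01 cg g_fixed).
Qed.

Let r_tail (e : R) : 0 < e -> exists m, forall k n, (m <= k)%N -> (k <= n)%N ->
  \sum_(k <= j < n) r j <= e.
Proof.
move=> e0.
have ndS : nondecreasing_seq (series r).
  by apply/nondecreasing_seqP => n; rewrite seriesSr lerDl; case/andP: (r01 n).
have cS : cvgn (series r).
  apply: nondecreasing_is_cvgn => //; exists rho => _ [n _ <-]; exact: r_sum.
have /cvgrPdist_le/(_ e e0)[m _ mS] := cS.
exists m => k n mk kn; rewrite -sub_series_geq//.
have := mS k mk; have := nondecreasing_cvgn_le ndS cS n.
by move=> ? /(le_trans (ler_norm _)); lra.
Qed.

(** Coordinates below a cutoff m contribute at most e / 2 by coordinatewise continuity. Beyond m,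
    the tails of g s and g t are each at most e / 4, uniformly for times up to t + 1. *)
Lemma fixed_point_ell1_path : ell_paths 1%E (@ell1_down R) g.
Proof.
split=> [t|t t0]; first exact: fixed_point_ell1_down.
apply: cvg_ell_norm0 => e e0.
have e4 : 0 < e / 4 by rewrite divr_gt0.
have e2 : 0 < e / 2 by rewrite divr_gt0.
have T0 : 0 <= t + 1 by rewrite addr_ge0.
have [N VN] := eventually0 T0.
have [m0 m0P] := r_tail e4.
(* With m > N, the term [V' m] feeding the tail is a reflection of index m - 1 >= N, hence zero up
   to time t + 1. *)
pose m := maxn N.+1 m0.
have tail s n : 0 <= s <= t + 1 -> (m <= n)%N -> \sum_(m <= j < n) g s j <= e / 4.
  move=> sT mn; have /andP[s0 _] := sT.
  apply: le_trans (fixed_point_sum_le lambda_ge0 r01 r_homo cg g_fixed g_bound s0 mn) _.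
  have : V' m s = 0.
    have : (N < m)%N by rewrite leq_maxl.
    by case: (m) => // m' Nm'; exact: VN.
  by move=> ->; rewrite addr0 m0P// leq_maxr.
have near_sum := @near_sum_dist_le _ (fun n s => g s n) m t (e / 2) cg e2.
near=> s.
have s0 : 0 <= s.
  have : `[0, +oo[%classic s by near: s; exact: withinT.
  by rewrite /= in_itv/= andbT.
have st : s <= t + 1.
  by near: s; apply: cvg_within; exact: near_le_add1.
apply: ell_norm1_le => n.
have sum_s : \sum_(0 <= j < m) `|g s j - g t j| <= e / 2.
  by near: s; apply: cvg_within; exact: near_sum.
(* Raising the upper index to the maximum permits splitting at m even when n < m. *)
have le_max_sum : \sum_(0 <= j < n) `|g s j - g t j| <=
    \sum_(0 <= j < maxn m n) `|g s j - g t j|.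
  rewrite [leRHS](@big_cat_nat _ _ _ n)//= ?leq_maxr// lerDl.
  by rewrite sumr_ge0.
apply: le_trans le_max_sum _.
rewrite (@big_cat_nat _ _ _ m)//= ?leq_maxl//.
have : \sum_(m <= j < maxn m n) `|g s j - g t j| <=
    \sum_(m <= j < maxn m n) g s j + \sum_(m <= j < maxn m n) g t j.
  rewrite -big_split /=; apply: ler_sum => j _.
  have := fixed_point_ge0 lambda_ge0 r01 cg g_fixed g_bound j s0.
  have := fixed_point_ge0 lambda_ge0 r01 cg g_fixed g_bound j t0.
  by rewrite ler_norml => ? ?; apply/andP; split; lra.
have tT : 0 <= t <= t + 1 by rewrite t0 lerDl ler01.
have sT : 0 <= s <= t + 1 by rewrite s0.
have := tail s _ sT (leq_maxl m n); have := tail t _ tT (leq_maxl m n).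
by lra.
Unshelve. all: by end_near.
Qed.

(** Only finitely many reflections are nonzero on a bounded time interval, so a finite sum of
    coordinate increments dominates the sup norm of the increment. *)
Lemma reflection_ell_path : ell_paths +oo%E (ell +oo%E) (fun t n => V n t).
Proof.
have le_sum N (T : R) s t n : (forall n t, (N <= n)%N -> 0 <= t <= T -> V n t = 0) ->
    0 <= s <= T -> 0 <= t <= T ->
    `|V n s - V n t| <= \sum_(0 <= j < N) `|V j s - V j t|.
  move=> VN sT tT; have [nN|Nn] := ltnP n N; last first.
    by rewrite !VN// subrr normr0 sumr_ge0.
  rewrite big_mkord (bigD1 (Ordinal nN))//= lerDl sumr_ge0//.
split=> [t t0|t t0].
- have [N VN] := eventually0 t0.
  apply/ellP; apply: (@le_lt_trans _ _ (\sum_(0 <= j < N) `|V j t - V j 0|)%:E).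
    apply: ell_normoo_le => [|n]; first by rewrite sumr_ge0.
    (* Since reflections vanish at time 0, the value at t is an increment and [le_sum] bounds it. *)
    have -> : V n t = V n t - V n 0 by rewrite (@reflection_npos _ lambda r r_le1 g n 0 cg (lexx _)) subr0.
    by apply: (le_sum N t); rewrite ?t0 ?lexx.
  by rewrite ltry.
- apply: cvg_ell_norm0 => e e0.
  have T0 : 0 <= t + 1 by rewrite addr_ge0.
  have [N VN] := eventually0 T0.
  have near_sum := @near_sum_dist_le _ V N t e (fun n => @reflection_continuous _ lambda r r_le1 g n cg) e0.
  near=> s.
  have s0 : 0 <= s.
    have : `[0, +oo[%classic s by near: s; exact: withinT.
    by rewrite /= in_itv/= andbT.
  have st : s <= t + 1.
    by near: s; apply: cvg_within; exact: near_le_add1.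
  apply: ell_normoo_le => [|n]; first exact: ltW.
  apply: le_trans (le_sum N (t + 1) _ _ _ VN _ _) _; rewrite ?s0 ?t0 ?lerDl ?ler01//.
  by near: s; apply: cvg_within; exact: near_sum.
Unshelve. all: by end_near.
Qed.

Lemma fixed_point_is_solution : is_solution lambda r g (fun t n => V n t).
Proof.
split; [exact: fixed_point_ell1_path|exact: reflection_ell_path|move=> n; split].
- split; last by rewrite -/(input lambda r g n) input_at0.
  by apply: continuous_rcll; exact: (@input_continuous _ lambda r r_le1 g n cg).
- by move=> t t0; rewrite g_fixed// /picard_map max_l.
- by move=> t _; rewrite reflectionE.
Qed.

End FixedPointSolution.

(** * Every solution is a fixed point of the Picard map *)

Section SolutionFixedPoint.
Variables (R : realType) (lambda : R) (r : nat -> R) (g v : R -> nat -> R).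
Hypothesis gv : is_solution lambda r g v.

(** A solution is constrained only for t >= 0; freezing it before 0 yields the continuity on all of
    R that the Picard estimates require. *)
Definition clipped (t : R) (n : nat) : R := g (Num.max t 0) n.

Lemma clippedE t : 0 <= t -> clipped t = g t.
Proof. by move=> t0; apply/funext => n; rewrite /clipped max_l. Qed.

(** A coordinate increment is at most the l_1 norm of the whole increment, so norm continuity passes
    to coordinates. *)
Lemma clipped_continuous : coordwise_continuous clipped.
Proof.
move=> n /= x; have [[_ gc] _ _] := gv.
have x0 : 0 <= Num.max x 0 by rewrite le_max lexx orbT.
apply/cvgrPdist_le => /= e e0.
have /fine_cvgP[fin_norm /cvgrPdist_le/(_ e e0) dist_norm] := gc _ x0.
(* Norm continuity holds within [[0, +oo[], where [Num.max y 0] always lies. *)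
have cmax : Num.max y 0 @[y --> x] --> within `[0, +oo[ (nbhs (Num.max x 0)).
  move=> A /=; rewrite /within/= => nA.
  have nx : \forall y \near x, Num.max y 0 \in `[0, +oo[%R -> A (Num.max y 0).
    exact: (@max0_continuous R x _ nA).
  suff : \forall y \near x, A (Num.max y 0) by [].
  by apply: filterS nx => y; apply; rewrite in_itv/= andbT le_max lexx orbT.
near=> y.
have fy : ell_norm 1%E (fun i => g (Num.max y 0) i - g (Num.max x 0) i) \is a fin_num.
  by near: y; exact: (cmax _ fin_norm).
have dy : `|0 - fine (ell_norm 1%E (fun i => g (Num.max y 0) i - g (Num.max x 0) i))| <= e.
  by near: y; exact: (cmax _ dist_norm).
rewrite distrC -lee_fin; apply: 
  le_trans (coord_le_ell_norm1 (fun i => g (Num.max y 0) i - g (Num.max x 0) i) n) _.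
rewrite -(fineK fy) lee_fin; apply: le_trans (ler_norm _) _.
by rewrite -normrN -sub0r.
Unshelve. all: by end_near.
Qed.

(** The n-th input determines v at index n, which enters the next input, so v is eliminated by
    induction on n. Only times in [0, t] matter, and clipping changes nothing there. *)
Lemma clipped_reflection n t : 0 <= t ->
  sys_input lambda r g v n t = input lambda r clipped n t /\
  v t n = reflection lambda r clipped n t.
Proof.
have [_ _ /(_ _) sys] := gv.
have refl m : (forall s, 0 <= s ->
      sys_input lambda r g v m s = input lambda r clipped m s) ->
    forall s, 0 <= s -> v s m = reflection lambda r clipped m s.
  move=> inputm s s0; have [_ _ ->//] := sys m.
  by rewrite reflectionE; apply: eq_skorohod_hat => u /andP[u0 _]; exact: inputm.
have prim_clipped m s : \int[lebesgue_measure]_(u in `[0, s]) (g u m - g u m.+1) =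
    prim (fun u => clipped u m - clipped u m.+1) s.
  apply: eq_Rintegral => u; rewrite inE/= in_itv/= => /andP[u0 _].
  by rewrite clippedE.
have input_eq m : forall s, 0 <= s ->
    sys_input lambda r g v m s = input lambda r clipped m s.
  elim: m => [|m IH] s s0; rewrite inputE /sys_input prim_clipped//=.
  by rewrite (refl m IH s s0) reflectionE.
by move=> t0; split; [exact: input_eq|exact: (refl n (input_eq n) t t0)].
Qed.

Lemma clipped_fixed t n : 0 <= t ->
  clipped t n = picard_map lambda r clipped t n.
Proof.
move=> t0; rewrite clippedE// picard_mapE//.
have [_ _ /(_ n)[_ gE vE]] := gv.
have [iE rE] := clipped_reflection n t0.
by rewrite gE// /skorohod -vE// iE rE.
Qed.

Lemma clipped01 t n : 0 <= t -> 0 <= clipped t n <= 1.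
Proof. by move=> t0; have [[/(_ t t0)[_ _ g01] _] _ _] := gv; rewrite clippedE. Qed.

End SolutionFixedPoint.

(** * Existence and uniqueness of the solution *)

Theorem proposition2p1 (R : realType) (lambda : R) (r : nat -> R)
    (hlambda : 0 < lambda) (hr : @ell1_down R r) :
  exists g v : R -> nat -> R,
    is_solution lambda r g v /\
    forall g' v' : R -> nat -> R, is_solution lambda r g' v' ->
      forall t : R, 0 <= t -> g' t = g t /\ v' t = v t.
Proof.
have [_ _ r01] := hr.
have r_le1 n : r n <= 1 by case/andP: (r01 n).
have l0 := ltW hlambda.
pose g := picard_lim lambda r.
have cg : coordwise_continuous g := @picard_lim_continuous _ lambda r l0 r01.
have g_fixed t n : 0 <= t -> g t n = picard_map lambda r g t n by exact: picard_lim_fixed.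
have g_bound T : exists2 C, 0 <= C & forall n t, 0 <= t <= T -> `|g t n| <= 2 ^+ n * C.
  (* Iterate 0 is the zero path, so the error estimate at index 0 bounds g itself; the absolute
     value makes the constant nonnegative for every T. *)
  exists `|picard_error lambda T 0| => // n t tT.
  have := picard_lim_error l0 r01 0 n tT; rewrite subr0 => /le_trans; apply.
  by rewrite ler_wpM2l ?exprn_ge0// ler_norm.
have sol := fixed_point_is_solution l0 hr cg g_fixed g_bound.
exists g, (fun t n => reflection lambda r g n t); split=> // g' v' sol' t t0.
have eqg n s : 0 <= s <= t -> clipped g' s n = g s n.
  apply: (@picard_fixed_point_unique _ lambda r r_le1 (clipped g') g t 1) => //.
  - exact: clipped_continuous sol'.
  - by move=> m u /andP[u0 _]; exact: clipped_fixed sol' _ _ u0.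
  - by move=> m u /andP[u0 _]; exact: g_fixed.
  (* Both paths have coordinates in [0, 1], so they differ by at most 1 <= 2^m. *)
  - move=> m u /andP[u0 _]; have := clipped01 sol' m u0.
    have [[gI _] _ _] := sol; have [_ _ /(_ m)] := gI u u0.
    have : 1 <= (2 : R) ^+ m by rewrite exprn_ege1// ler1n.
    rewrite mulr1 ler_norml => ? /andP[? ?] /andP[? ?]; apply/andP; split; lra.
have tt : 0 <= t <= t by rewrite t0 lexx.
split; apply/funext => n; first by rewrite -eqg// clippedE.
have [_ ->] := clipped_reflection sol' n t0.
(* As the two g-paths agree on [0, t], the estimate with constant C = 0 forces equal reflections. *)
have := @reflection_contraction _ lambda r r_le1 (clipped g') g t 0 0
  (clipped_continuous sol') cg (lexx _).
case/(_ _ n t tt); first by move=> m u uT; rewrite eqg// subrr normr0 mulr0 mul0r.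
by move=> _; rewrite mul0r mulr0 mul0r normr_le0 subr_eq0 => /eqP.
Qed.
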